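(* Let $a\geq 1$, $m\geq 1$ and $n\geq 3$ be integers. The graph $EGW(a,m,n)=a\overline{K_m}\nabla C_n$ on $am+n$ vertices is $D$-integral if and only if $$(a,m,n)\in\{(1,4,3),(4,1,3),(2,2,3),(1,1,3),(1,2,4),(2,1,4),(1,4,6),(2,2,6),(4,1,6),(1,12,6),(2,6,6),(3,4,6),(4,3,6),(6,2,6),(12,1,6)\}.$$
   Context: All graphs are finite, simple and connected. $\overline{K_m}$ is the edgeless graph on $m$ vertices, $a\overline{K_m}$ denotes the disjoint union of $a$ copies of $\overline{K_m}$, and $C_n$ is the cycle on $n$ vertices. For graphs $G_1,G_2$, the join $G_1\nabla G_2$ is obtained from the disjoint union $G_1\cup G_2$ by adding all edges between a vertex of $G_1$ and a vertex of $G_2$. The distance matrix $D(G)$ of a connected graph $G$ has as $(i,j)$-entry the length of a shortest path between $v_i$ and $v_j$. A graph $G$ is $D$-integral if all eigenvalues of $D(G)$ are integers. *)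

(* Defs.v *)
From HB Require Import structures.
From mathcomp Require Import all_boot all_order all_algebra all_field.

Set Implicit Arguments.
Unset Strict Implicit.
Unset Printing Implicit Defensive.

Import Order.TTheory GRing.Theory Num.Theory.

Record sgraph := SGraph {
  vertex :> finType;
  adj : rel vertex;
  adj_sym : symmetric adj;
  adj_irrefl : irreflexive adj }.

Section Distance.
Variable G : sgraph.
Implicit Types x y : G.

Definition connected_graph : Prop := forall x y, connect (@adj G) x y.

Definition has_walk x y (k : nat) : bool :=
  [exists p : k.-tuple G, path (@adj G) x p && (last x p == y)].

(* A shortest path has length < #|G|; the value is #|G| for vertices lying in
   different components, which does not happen in a connected graph. *)
Definition gdist x y : nat := find (has_walk x y) (iota 0 #|G|).

Lemma gdistP x y : connect (@adj G) x y ->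
  has_walk x y (gdist x y) /\ forall k, has_walk x y k -> gdist x y <= k.
Proof.
move=> /connectP[p0 /shortenP[p xp Up _] ey].
have wp : has_walk x y (size p).
  by apply/existsP; exists (in_tuple p); rewrite /= xp ey eqxx.
have sp : size p < #|G| by rewrite -[_.+1]/(size (x :: p)) -(card_uniqP Up) max_card.
have hs : has (has_walk x y) (iota 0 #|G|).
  by apply/hasP; exists (size p); rewrite ?mem_iota.
have lt : gdist x y < #|G| by move: hs; rewrite has_find size_iota.
split; first by have := nth_find 0 hs; rewrite nth_iota.
move=> k wk; rewrite leqNgt; apply/negP => klt.
by have := before_find 0 klt; rewrite nth_iota ?(ltn_trans klt) // add0n wk.
Qed.

Definition distmx : 'M[algC]_#|G| :=
  \matrix_(i, j) (gdist (enum_val i) (enum_val j))%:R%R.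

Definition D_integral : Prop :=
  forall z : algC, eigenvalue distmx z -> z \is a Num.int.

End Distance.

Section Edgeless.
Variable m : nat.
Definition edgeless_adj : rel 'I_m := fun _ _ => false.
Fact edgeless_sym : symmetric edgeless_adj. Proof. by []. Qed.
Fact edgeless_irrefl : irreflexive edgeless_adj. Proof. by []. Qed.
Definition edgeless := SGraph edgeless_sym edgeless_irrefl.
End Edgeless.

Section Cycle.
Variable n : nat.
(* The condition i != j only matters for n = 1, where it removes a loop. *)
Definition cycle_adj : rel 'I_n := fun i j =>
  (i != j) && ((j == i.+1 %% n :> nat) || (i == j.+1 %% n :> nat)).
Fact cycle_sym : symmetric cycle_adj.
Proof. by move=> i j; rewrite /cycle_adj eq_sym orbC. Qed.
Fact cycle_irrefl : irreflexive cycle_adj.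
Proof. by move=> i; rewrite /cycle_adj eqxx. Qed.
Definition cycle_graph := SGraph cycle_sym cycle_irrefl.
End Cycle.

Section Copies.
Variables (a : nat) (G : sgraph).
Definition copies_adj : rel ('I_a * G)%type := fun u v =>
  (u.1 == v.1) && adj u.2 v.2.
Fact copies_sym : symmetric copies_adj.
Proof. by move=> u v; rewrite /copies_adj eq_sym adj_sym. Qed.
Fact copies_irrefl : irreflexive copies_adj.
Proof. by move=> u; rewrite /copies_adj adj_irrefl andbF. Qed.
Definition copies := SGraph copies_sym copies_irrefl.
End Copies.

Section Join.
Variables G1 G2 : sgraph.
Definition join_adj : rel (G1 + G2)%type := fun u v =>
  match u, v with
  | inl x, inl y => adj x y
  | inr x, inr y => adj x y
  | _, _ => true
  end.
Fact join_sym : symmetric join_adj.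
Proof. by move=> [x|x] [y|y] //=; rewrite adj_sym. Qed.
Fact join_irrefl : irreflexive join_adj.
Proof. by move=> [x|x] /=; rewrite adj_irrefl. Qed.
Definition join := SGraph join_sym join_irrefl.
End Join.

Definition EGW (a m n : nat) : sgraph :=
  join (copies a (edgeless m)) (cycle_graph n).

Lemma card_EGW a m n : #|EGW a m n| = a * m + n.
Proof. by rewrite card_sum card_prod !card_ord. Qed.

Lemma EGW_connected a m n :
  0 < a -> 0 < m -> 0 < n -> connected_graph (EGW a m n).
Proof.
move=> a0 m0 n0.
pose u : EGW a m n := inl (Ordinal a0, Ordinal m0).
pose v : EGW a m n := inr (Ordinal n0).
have uv : connect (@adj (EGW a m n)) u v by apply: connect1.
have vu : connect (@adj (EGW a m n)) v u by apply: connect1.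
have to_u (x : EGW a m n) : connect (@adj (EGW a m n)) x u.
  by case: x => x; [apply: connect_trans vu|]; apply: connect1.
have from_u (x : EGW a m n) : connect (@adj (EGW a m n)) u x.
  by case: x => x; [apply: connect_trans uv _|]; apply: connect1.
by move=> x y; apply: connect_trans (to_u x) (from_u y).
Qed.

(* Main.v *)
(** Put [N = a * m].  The distance matrix splits along functions that are
    supported on one side of the join and sum to [0], on which its eigenvalues
    are [-2] (edgeless side) and [-2 - (w + w^-1)] with [w <> 1], [w ^ n = 1]
    (cycle side), and functions that are constant on each side, which contribute
    the roots of [(z - (N + n - 3))^2 = (N - n + 1)^2 + N n].  Integrality of
    [w + w^-1] for a primitive [w] forces [n] to be [3], [4] or [6]; for these
    [n] the right-hand side is a square only for the listed values of [N],
    because it otherwise lies strictly between two consecutive squares. *)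
Require Import Defs.
From HB Require Import structures.
From mathcomp Require Import all_boot all_order all_algebra all_field.
From mathcomp Require Import zify ring.

Set Implicit Arguments.
Unset Strict Implicit.
Unset Printing Implicit Defensive.

Import Order.TTheory GRing.Theory Num.Theory.
Local Open Scope ring_scope.

(** * Eigenvalue equations as sums over vertices, and distances at most 2 *)

Lemma eigenvalue_distmxP (G : sgraph) (z : algC) :
  reflect (exists2 f : G -> algC, exists x, f x != 0 &
             forall y, \sum_x f x * (gdist x y)%:R = z * f y)
          (eigenvalue (distmx G) z).
Proof.
apply: (iffP (@eigenvalueP _ _ _ _)) => [[v vD v0] | [f [x fx0] fD]].
  exists (fun x => v 0 (enum_rank x)).
    case/rV0Pn: v0 => i vi0; exists (enum_val i).
    by rewrite enum_valK.
  move=> y; have /rowP/(_ (enum_rank y)) := vD; rewrite !mxE => <-.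
  rewrite (reindex _ (onW_bij _ (@enum_val_bij G))) /=.
  by apply: eq_bigr => i _; rewrite enum_valK mxE enum_rankK.
exists (\row_i f (enum_val i)); last first.
  by apply/rV0Pn; exists (enum_rank x); rewrite mxE enum_rankK.
apply/rowP=> j; rewrite !mxE -fD (reindex _ (onW_bij _ (@enum_val_bij G))) /=.
by apply: eq_bigr => i _; rewrite !mxE.
Qed.

(** The hypothesis provides a walk of length 1 or 2, so only the lengths 0, 1, 2 compete, and walks
    of length 0 and 1 amount to equality and adjacency. *)
Lemma gdist_diam2 (G : sgraph) (x y : G) :
    adj x y || [exists t, adj x t && adj t y] ->
  gdist x y = if x == y then 0%N else if adj x y then 1%N else 2%N.
Proof.
move=> xy.
have walk0 : has_walk x y 0 = (x == y).
  apply/existsP/eqP => [[p]|->]; first by rewrite tuple0 /= => /eqP.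
  by exists [tuple]; rewrite /= eqxx.
have walk1 : has_walk x y 1 = adj x y.
  apply/existsP/idP => [[p]|axy].
    by case/tupleP: p => t p; rewrite tuple0 /= andbT => /andP[xt /eqP <-].
  by exists [tuple y]; rewrite /= axy eqxx.
have walk2 : [exists t, adj x t && adj t y] -> has_walk x y 2.
  case/existsP => t /andP[xt ty]; apply/existsP; exists [tuple t; y].
  by rewrite /= xt ty eqxx.
have cxy : connect (@adj G) x y.
  case/orP: xy => [/connect1 //|/existsP[t /andP[xt ty]]].
  exact: connect_trans (connect1 xt) (connect1 ty).
have [wd mind] := gdistP cxy.
case: ifP => [xy0|xyF]; first by apply/eqP; rewrite -leqn0 mind ?walk0.
have d0 : gdist x y != 0%N by apply/negP => /eqP d0; rewrite d0 walk0 xyF in wd.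
case: ifP => [axy|axyF].
  by have := mind 1%N; rewrite walk1 => /(_ axy); lia.
have d1 : gdist x y != 1%N by apply/negP => /eqP d1; rewrite d1 walk1 axyF in wd.
by rewrite axyF /= in xy; have := mind 2%N (walk2 xy); lia.
Qed.

(** * Neighbours on the cycle *)

Lemma ordS_neq n (i : 'I_n) : (1 < n)%N -> ordS i != i.
Proof.
move=> n1; rewrite -val_eqE /=.
have := ltn_ord i; rewrite leq_eqVlt => /orP[/eqP iE|lin].
  by rewrite iE modnn; lia.
by rewrite modn_small //; lia.
Qed.

Lemma cycle_adjE n (i j : 'I_n) : (2 < n)%N ->
  cycle_adj j i = (j == ordS i) || (j == ord_pred i).
Proof.
move=> n2; rewrite /cycle_adj.
have -> : (j == i.+1 %% n :> nat)%N = (j == ordS i) by [].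
have -> : (i == j.+1 %% n :> nat)%N = (j == ord_pred i).
  by rewrite -(inj_eq (@ordS_inj n)) ord_predK eq_sym.
rewrite orbC; have [->|//] := eqVneq j i; apply/esym/negbTE.
rewrite negb_or eq_sym ordS_neq ?(ltnW n2) //=.
by rewrite -(inj_eq (@ordS_inj n)) ord_predK ordS_neq ?(ltnW n2).
Qed.

(** For [n > 2], two steps forward never return to the start. This lets [gdist_inrr] write adjacency
    as a sum of two indicators. *)
Lemma ordS_neq_pred n (i : 'I_n) : (2 < n)%N -> ordS i != ord_pred i.
Proof.
move=> n2; rewrite -(inj_eq (@ordS_inj n)) ord_predK -val_eqE /=.
have := ltn_ord i; rewrite leq_eqVlt => /orP[/eqP iE|lin].
  by rewrite iE modnn modn_small; lia.
rewrite (modn_small lin); move: lin; rewrite leq_eqVlt => /orP[/eqP iE|lin].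
  by rewrite iE modnn; lia.
by rewrite modn_small //; lia.
Qed.

(** * Roots of unity and eigenvalues of the cycle *)

Lemma prim_root_neq0 (F : fieldType) n (w : F) :
  n.-primitive_root w -> (0 < n)%N -> w != 0.
Proof.
move=> wprim n_gt0; apply/eqP => w0; have := prim_expr_order wprim.
by move/eqP; rewrite w0 expr0n gtn_eqF // eq_sym oner_eq0.
Qed.

(** As [w] has modulus 1, the integer [k = w + w^-1] lies between -2 and 2, and [w] is a root of
    [X^2 - k X + 1]. The values -2 and 2 force [w = -1] and [w = 1], so that [n] would divide 2; the
    values -1, 0, 1 give [w^3 = 1], [w^4 = 1], [w^6 = 1]. *)
Lemma prim_root_trace_int_order n (w : algC) :
  (2 < n)%N -> n.-primitive_root w -> w + w^-1 \is a Num.int -> n \in [:: 3; 4; 6]%N.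
Proof.
move=> n_gt2 wprim /intrP[k kE].
have w0 : w != 0 := prim_root_neq0 wprim (ltnW (ltnW n_gt2)).
have w1 : `|w| = 1.
  apply/eqP; rewrite -(@pexpr_eq1 _ _ n) ?normr_ge0 //; last by lia.
  by rewrite -normrX (prim_expr_order wprim) normr1.
have : `|k| <= 2.
  rewrite -(ler_int algC) intr_norm -kE; apply: le_trans (ler_normD _ _) _.
  by rewrite normfV w1 invr1.
have quad : w ^+ 2 = k%:~R * w - 1 by rewrite -kE; field.
have dvd e : w ^+ e = 1 -> (n %| e)%N by move/eqP; rewrite -(prim_order_dvd wprim).
have dvd2 : ~ (n %| 2)%N by move/dvdn_leq => /(_ isT); lia.
move=> k2; have : k \in [:: -2; -1; 0; 1; 2] by rewrite !inE; lia.
rewrite !inE; do 4?case/orP; move=> /eqP kk; rewrite {}kk in quad.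
- have /eqP : (w + 1) ^+ 2 = 0 by rewrite sqrrD quad; ring.
  rewrite expf_eq0 /= addr_eq0 => /eqP we.
  by case: dvd2; apply: dvd; rewrite we; ring.
- have /dvd : w ^+ 3 = 1.
    by rewrite exprS quad mulrBr mulrCA -expr2 quad; ring.
  by move/dvdn_leq => /(_ isT); lia.
- have /dvd d4 : w ^+ 4 = 1 by rewrite (exprM w 2 2) quad; ring.
  by have := dvdn_leq (isT : (0 < 4)%N) d4; case: (n) n_gt2 d4 => [|[|[|[|[|?]]]]].
- have /dvd d6 : w ^+ 6 = 1.
    have -> : w ^+ 6 = (w * w ^+ 2) ^+ 2 by ring.
    by rewrite quad mulrBr mulrCA -expr2 quad; ring.
  by have := dvdn_leq (isT : (0 < 6)%N) d6; case: (n) n_gt2 d6 => [|[|[|[|[|[|[|?]]]]]]].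
have /eqP : (w - 1) ^+ 2 = 0 by rewrite sqrrB quad; ring.
rewrite expf_eq0 /= subr_eq0 => /eqP we.
by case: dvd2; apply: dvd; rewrite we; ring.
Qed.

(* Two steps ([n = 3, 4]) or three steps ([n = 6]) of the recurrence in both
   directions end at the same vertex or at adjacent ones, which gives a
   polynomial with integer roots that vanishes at [c]. *)
Lemma cycle_eigenvalue_int n (g : 'I_n -> algC) (c : algC) (i : 'I_n) :
    n \in [:: 3; 4; 6]%N -> g i != 0 ->
    (forall j, g (ordS j) + g (ord_pred j) = c * g j) ->
  c \is a Num.int.
Proof.
move=> nE gi0 gc.
have int_root (k : int) : c - k%:~R == 0 -> c \is a Num.int.
  by rewrite subr_eq0 => /eqP ->; rewrite rpred_int.
have kill p : p * g i = 0 -> p = 0.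
  by move/eqP; rewrite mulf_eq0 (negPf gi0) orbF => /eqP.
have gc2 j : c ^+ 2 * g j
    = g (ordS (ordS j)) + 2 * g j + g (ord_pred (ord_pred j)).
  rewrite expr2 -mulrA -gc mulrDr -!gc ordSK ord_predK; ring.
move: nE; rewrite !inE => /or3P[] /eqP nE.
- have SS j : ordS (ordS j) = ord_pred j :> 'I_n.
    apply: val_inj; have := ltn_ord j; rewrite /=.
    by move: (nat_of_ord j) => v; rewrite nE; case: v => [|[|[|]]].
  have PP j : ord_pred (ord_pred j) = ordS j :> 'I_n.
    by rewrite -[in LHS]SS ord_predK.
  have /kill/eqP : ((c - 2%:~R) * (c - (-1)%:~R)) * g i = 0.
    transitivity (c ^+ 2 * g i - c * g i - 2 * g i); first by ring.
    by rewrite gc2 SS PP -gc; ring.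
  by rewrite mulf_eq0 => /orP[] /int_root.
- have SS j : ordS (ordS j) = ord_pred (ord_pred j) :> 'I_n.
    apply: val_inj; have := ltn_ord j; rewrite /=.
    by move: (nat_of_ord j) => v; rewrite nE; case: v => [|[|[|[|]]]].
  (* If [c = u + u^-1], then [c^2 - 2 = u^2 + u^-2]: two steps each way, which meet at the antipode
     of the 4-cycle. Applying this twice gives [(c^2 - 2)^2 = 4], that is
     [c^2 (c - 2) (c + 2) = 0]. *)
  have anti j : (c ^+ 2 - 2) * g j = 2 * g (ordS (ordS j)).
    by rewrite mulrBl gc2 -SS; ring.
  have /kill/eqP : (c - 0%:~R) * (c - 0%:~R) * ((c - 2%:~R) * (c - (-2)%:~R)) * g i = 0.
    transitivity ((c ^+ 2 - 2) * ((c ^+ 2 - 2) * g i) - 4 * g i); first by ring.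
    by rewrite anti mulrCA anti [ordS (ordS (ordS _))]SS !ordSK; ring.
  by rewrite !mulf_eq0 => /orP[] /orP[] /int_root.
have SSS j : ordS (ordS (ordS j)) = ord_pred (ord_pred (ord_pred j)) :> 'I_n.
  apply: val_inj; have := ltn_ord j; rewrite /=.
  by move: (nat_of_ord j) => v; rewrite nE; case: v => [|[|[|[|[|[|]]]]]].
(* Likewise [c^3 - 3 c = u^3 + u^-3] is three steps each way on the 6-cycle. Hence
   [(c^3 - 3 c)^2 = 4], which factors as [(c - 2) (c + 1)^2 (c + 2) (c - 1)^2 = 0]. *)
have anti j : (c ^+ 3 - 3 * c) * g j = 2 * g (ordS (ordS (ordS j))).
  rewrite mulrBl exprS -mulrA gc2 !mulrDr mulrCA -!gc -mulrA -gc ordSK.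
  by rewrite ord_predK -SSS; ring.
have /kill/eqP : ((c - 2%:~R) * ((c - (-1)%:~R) * (c - (-1)%:~R))
    * ((c - (-2)%:~R) * ((c - 1%:~R) * (c - 1%:~R)))) * g i = 0.
  transitivity ((c ^+ 3 - 3 * c) * ((c ^+ 3 - 3 * c) * g i) - 4 * g i).
    by ring.
  by rewrite anti mulrCA anti [ordS (ordS (ordS (ordS _)))]SSS !ordSK; ring.
by rewrite !mulf_eq0 => /orP[] /orP[/int_root //|/orP[] /int_root].
Qed.

(** * The distance matrix of the join and its spectrum *)

Section EGW_distance.
Variables (a m n : nat).
Hypotheses (a_gt0 : (0 < a)%N) (m_gt0 : (0 < m)%N) (n_gt2 : (2 < n)%N).
Local Notation G := (EGW a m n).
Local Notation T := ('I_a * 'I_m)%type.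

Lemma gdist_inlr (x : T) (i : 'I_n) :
  @gdist G (inl x) (inr i) = 1%N /\ @gdist G (inr i) (inl x) = 1%N.
Proof. by split; rewrite gdist_diam2. Qed.

Lemma gdist_inll (x y : T) :
  @gdist G (inl x) (inl y) = (2 - 2 * (x == y))%N.
Proof.
rewrite gdist_diam2 /=; last first.
  apply/orP; right; apply/existsP.
  by exists (inr (Ordinal (ltnW (ltnW n_gt2)))).
rewrite /copies_adj /= /edgeless_adj andbF.
have -> : (inl x == inl y :> G) = (x == y) by [].
by case: (x == y).
Qed.

(** Entrywise this is [2 J - 2 I - A], with the adjacency matrix [A] of the cycle split into two
    shifts; a sum against [f] then reduces to the total of [f] and three of its values. *)
Lemma gdist_inrr (i j : 'I_n) :
  (@gdist G (inr j) (inr i))%:R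
    = 2 - 2 * (j == i)%:R - (j == ordS i)%:R - (j == ord_pred i)%:R :> algC.
Proof.
rewrite gdist_diam2 /=; last first.
  apply/orP; right; apply/existsP.
  by exists (inl (Ordinal a_gt0, Ordinal m_gt0)).
have -> : (inr j == inr i :> G) = (j == i) by [].
have /norP[/negPf iS /negPf iP] : ~~ ((i == ordS i) || (i == ord_pred i)).
  by rewrite -cycle_adjE // cycle_irrefl.
rewrite cycle_adjE //; have [->|_] := eqVneq j i; first by rewrite iS iP /=; ring.
have [->|_] := eqVneq j (ordS i).
  by rewrite (negPf (ordS_neq_pred i n_gt2)) /=; ring.
by case: (j == _) => /=; ring.
Qed.

Lemma sum_gdist_inl (f : G -> algC) (y : T) :
  \sum_x f x * (gdist x (inl y : G))%:R =
  2 * \sum_(x : T) f (inl x) - 2 * f (inl y) + \sum_(i < n) f (inr i).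
Proof.
rewrite big_sumType /=; congr (_ + _); last first.
  by apply: eq_bigr => i _; rewrite (gdist_inlr y i).2 mulr1.
rewrite [in RHS](bigD1 y) //= (bigD1 y) //= gdist_inll eqxx mulr0 add0r.
rewrite (eq_bigr (fun x => 2 * f (inl x))) => [|x /negPf xy].
  by rewrite -mulr_sumr; ring.
by rewrite gdist_inll xy mulrC.
Qed.

Lemma sum_gdist_inr (f : G -> algC) (i : 'I_n) :
  \sum_x f x * (gdist x (inr i : G))%:R =
  \sum_(x : T) f (inl x) + 2 * \sum_(j < n) f (inr j) - 2 * f (inr i)
    - (f (inr (ordS i)) + f (inr (ord_pred i))).
Proof.
rewrite big_sumType /=.
rewrite (eq_bigr (fun x => f (inl x))) => [|x _]; last first.
  by rewrite (gdist_inlr x i).1 mulr1.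
have pick (k : 'I_n) : f (inr k) = \sum_j f (inr j) * (j == k)%:R.
  rewrite (bigD1 k) //= eqxx mulr1 big1 ?addr0 // => j /negPf ->.
  by rewrite mulr0.
rewrite -!addrA; congr (_ + _).
rewrite (pick i) (pick (ordS i)) (pick (ord_pred i)).
rewrite !mulr_sumr -big_split /= -!sumrN -!big_split /=.
by apply: eq_bigr => j _; rewrite gdist_inrr; ring.
Qed.

(** For [d] the right-hand side and [N = a * m], the number [sqrtC d + (N + n - 3)] is an
    eigenvalue, so [sqrtC d] is an integer. *)
Lemma D_integral_EGW_square : D_integral G ->
  exists k : int, k ^+ 2 = ((a * m)%:Z - n%:Z + 1) ^+ 2 + (a * m * n)%:Z.
Proof.
move=> Dint; set d := _ ^+ 2 + (a * m * n)%:Z.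
have [N NE] : exists N : algC, N = (a * m)%:R by exists (a * m)%:R.
have dE : d%:~R = (N - n%:R + 1) ^+ 2 + N * n%:R.
  rewrite /d rmorphD rmorphXn /= rmorphD rmorphB /= -!pmulrn.
  by rewrite (natrM _ (a * m) n) NE.
have root_int (l : algC) :
    (l - (N + n%:R - 3)) ^+ 2 = (N - n%:R + 1) ^+ 2 + N * n%:R ->
  l \is a Num.int.
  move=> lE; apply/Dint/eigenvalue_distmxP.
  (* The value on the cycle is chosen to solve the equation at edgeless vertices; the equation at
     cycle vertices then reads [(l - 2 N + 2) (l - 2 n + 4) = N n], which is [lE] expanded. *)
  exists (fun x : G => if x is inl _ then n%:R else l - 2 * N + 2).
    by exists (inl (Ordinal a_gt0, Ordinal m_gt0)); rewrite pnatr_eq0; lia.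
  have cardT : #|{: T}| = (a * m)%N by rewrite card_prod !card_ord.
  case=> [y|i]; rewrite ?sum_gdist_inl ?sum_gdist_inr !sumr_const cardT card_ord.
    by rewrite -[n%:R *+ _]mulr_natr -[_ *+ n]mulr_natr -NE; ring.
  rewrite -[n%:R *+ _]mulr_natr -[_ *+ n]mulr_natr -NE.
  apply/eqP; rewrite -subr_eq0; apply/eqP.
  transitivity ((N - n%:R + 1) ^+ 2 + N * n%:R - (l - (N + n%:R - 3)) ^+ 2).
    by ring.
  by rewrite lE subrr.
have Nn_int : N + n%:R - 3 \is a Num.int.
  by rewrite NE; apply: rpredB; [apply: rpredD|]; apply: rpred_nat.
have : sqrtC d%:~R + (N + n%:R - 3) \is a Num.int.
  by apply: root_int; rewrite addrK sqrtCK dE.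
rewrite rpredDr // => /intrP[k kE]; exists k; apply/eqP.
by rewrite -(eqr_int algC) -(sqrtCK d%:~R) kE rmorphXn.
Qed.

Lemma D_integral_EGW_cycle : D_integral G -> n \in [:: 3; 4; 6]%N.
Proof.
move=> Dint; have n_gt0 : (0 < n)%N by lia.
have [w wprim] := C_prim_root_exists n_gt0.
apply: (prim_root_trace_int_order n_gt2 wprim).
have w0 : w != 0 := prim_root_neq0 wprim n_gt0.
have wS (i : 'I_n) : w ^+ ordS i = w * w ^+ i.
  by rewrite /= (prim_expr_mod wprim) exprS.
have wP (i : 'I_n) : w ^+ ord_pred i = w^-1 * w ^+ i.
  by rewrite -[in RHS](ord_predK i) wS mulKf.
have sumw : \sum_(i < n) w ^+ i = 0.
  have /eqP := subrX1 w n; rewrite (prim_expr_order wprim) subrr eq_sym mulf_eq0.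
  case/orP => [|/eqP //]; rewrite subr_eq0 -[w]expr1 -(prim_order_dvd wprim).
  by move/dvdn_leq => /(_ isT); lia.
have : - 2 - (w + w^-1) \is a Num.int.
  apply/Dint/eigenvalue_distmxP.
  (* On powers of [w] the two shifts act as multiplication by [w] and [w^-1], and the total [sumw]
     vanishes because [w <> 1]. *)
  exists (fun x : G => if x is inr i then w ^+ (i : 'I_n) else 0).
    by exists (inr (Ordinal n_gt0)); rewrite expr0 oner_neq0.
  case=> [y|i]; rewrite ?sum_gdist_inl ?sum_gdist_inr sumw big1 //; first by ring.
  by rewrite wS wP; ring.
move=> h; have -> : w + w^-1 = - 2 - (- 2 - (w + w^-1)) by ring.
by rewrite rpredB // rpredN rpred_nat.
Qed.

Lemma EGW_D_integral (k : int) : n \in [:: 3; 4; 6]%N ->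
    k ^+ 2 = ((a * m)%:Z - n%:Z + 1) ^+ 2 + (a * m * n)%:Z ->
  D_integral G.
Proof.
move=> nE kE z /eigenvalue_distmxP[f [x0 fx0] fz].
have [N NE] : exists N : algC, N = (a * m)%:R by exists (a * m)%:R.
have kC : k%:~R ^+ 2 = (N - n%:R + 1) ^+ 2 + N * n%:R :> algC.
  rewrite -rmorphXn kE rmorphD rmorphXn /= rmorphD rmorphB /= -!pmulrn.
  by rewrite (natrM _ (a * m) n) NE.
have [S1 S1E] : exists S, S = \sum_(x : T) f (inl x) by eexists.
have [S2 S2E] : exists S, S = \sum_(i < n) f (inr i) by eexists.
have fl (y : T) : 2 * S1 - 2 * f (inl y) + S2 = z * f (inl y).
  by rewrite -fz sum_gdist_inl S1E S2E.
have fr (i : 'I_n) : S1 + 2 * S2 - 2 * f (inr i)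
    - (f (inr (ordS i)) + f (inr (ord_pred i))) = z * f (inr i).
  by rewrite -fz sum_gdist_inr S1E S2E.
have cardT : #|{: T}| = (a * m)%N by rewrite card_prod !card_ord.
have E1 : (z - 2 * N + 2) * S1 = N * S2.
  have : \sum_(y : T) (2 * S1 - 2 * f (inl y) + S2) = z * S1.
    by rewrite [in RHS]S1E mulr_sumr; apply: eq_bigr => y _; apply: fl.
  rewrite big_split sumrB /= !sumr_const cardT -mulr_sumr -S1E.
  by rewrite -[(2 * S1) *+ _]mulr_natr -[S2 *+ _]mulr_natr -NE => E; rewrite mulrDl mulrBl -E; ring.
have E2 : (z - 2 * n%:R + 4) * S2 = n%:R * S1.
  have : \sum_(i < n) (S1 + 2 * S2 - 2 * f (inr i)
      - (f (inr (ordS i)) + f (inr (ord_pred i)))) = z * S2.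
    by rewrite [in RHS]S2E mulr_sumr; apply: eq_bigr => i _; apply: fr.
  have SS : \sum_(i < n) f (inr (ordS i)) = S2.
    by rewrite S2E [RHS](reindex_inj (@ordS_inj n)).
  have SP : \sum_(i < n) f (inr (ord_pred i)) = S2.
    by rewrite S2E [RHS](reindex_inj (@ord_pred_inj n)).
  rewrite !sumrB !big_split /= SS SP !sumr_const card_ord -mulr_sumr -S2E.
  by rewrite -[S1 *+ _]mulr_natr -[(2 * S2) *+ _]mulr_natr => E; rewrite mulrDl mulrBl -E; ring.
(* [E1] and [E2] form a 2 by 2 system whose determinant kills both [S1] and [S2]. If one of them is
   nonzero, the determinant vanishes, and completing the square gives [z = N + n - 3] plus or minus
   [k]. *)
have det (S : algC) : S != 0 ->
    ((z - 2 * N + 2) * (z - 2 * n%:R + 4) - N * n%:R) * S = 0 ->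
  z \is a Num.int.
  move=> S0 /eqP; rewrite mulf_eq0 (negPf S0) orbF => /eqP zE.
  have : (z - (N + n%:R - 3)) ^+ 2 == k%:~R ^+ 2.
    by rewrite kC -subr_eq0; apply/eqP; rewrite -zE; ring.
  rewrite eqf_sqr => zk.
  have -> : z = (z - (N + n%:R - 3)) + (N + n%:R - 3) by ring.
  apply: rpredD; last first.
    by rewrite NE; apply: rpredB; [apply: rpredD|]; apply: rpred_nat.
  by case/orP: zk => /eqP ->; rewrite ?rpredN rpred_int.
have [S10|S10] := eqVneq S1 0; last first.
  apply: (det _ S10); rewrite mulrBl mulrAC E1.
  by rewrite -!mulrA [S2 * _]mulrC E2; ring.
have [S20|S20] := eqVneq S2 0; last first.
  apply: (det _ S20); rewrite mulrBl -mulrA E2.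
  by rewrite mulrCA E1; ring.
(* Both side sums are now 0, so a nonzero value on the edgeless side forces [z = -2]. *)
have [/existsP[y fy0]|] := boolP [exists y : T, f (inl y) != 0].
  have : (z + 2) * f (inl y) == 0.
    by rewrite mulrDl -fl S10 S20; apply/eqP; ring.
  rewrite mulf_eq0 (negPf fy0) orbF addr_eq0 => /eqP ->.
  by rewrite rpredN rpred_nat.
rewrite negb_exists => /forallP fl0.
case: x0 fx0 => [y|i] fi0; first by have := fl0 y; rewrite fi0.
(* Here [f] lives on the cycle, where it is an adjacency eigenfunction for [-(z + 2)]. *)
have : - (z + 2) \is a Num.int.
  apply: (@cycle_eigenvalue_int n (fun j => f (inr j)) _ i) => // j.
  by rewrite mulNr mulrDl -fr S10 S20; ring.
move=> h; have -> : z = - (- (z + 2)) - 2 by ring.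
by rewrite rpredB ?rpredN ?rpred_nat // -rpredN.
Qed.

End EGW_distance.

(** * The Diophantine condition on [N] and [n] *)

Lemma square_EGW_params (N n : nat) (k : int) :
    (0 < N)%N -> n \in [:: 3; 4; 6]%N ->
    k ^+ 2 = (N%:Z - n%:Z + 1) ^+ 2 + (N * n)%:Z ->
  (N, n) \in [:: (1, 3); (4, 3); (2, 4); (4, 6); (12, 6)]%N.
Proof.
wlog k0 : k / 0 <= k => [hw N0 nE kE|N0].
  have [|k0] := leP 0 k => [/hw|]; first exact.
  by apply: (hw (- k)) => //; [lia | rewrite sqrrN].
have N1 : 1 <= N%:Z by lia.
rewrite !inE !xpair_eqE PoszM -!eqz_nat.
move: N%:Z N1 => M M1.
(* Once [M] and [k] are bounded, the equation is settled by exhaustive computation. *)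
have decide (b c : nat) (f : int -> int) (s : seq int) :
    M <= b%:Z -> k <= c%:Z -> k * k = f M ->
    all (fun x : nat =>
      all (fun y : nat => (y%:Z * y%:Z == f x%:Z) ==> (x%:Z \in s)) (iota 0 c.+1))
      (iota 1 b) -> M \in s.
  move=> Mb kc kE /allP/(_ `|M|%N); rewrite mem_iota => /(_ ltac:(lia)).
  move=> /allP/(_ `|k|%N); rewrite mem_iota => /(_ ltac:(lia)).
  by rewrite !gez0_abs ?kE ?eqxx //; lia.
move=> /or3P[] /eqP -> kE.
- have {}kE : k * k = M * M - M + 4 by rewrite -expr2 kE; ring.
  (* From [M = 5] on, [M^2 - M + 4] lies strictly between [(M - 1)^2] and [M^2]. *)
  have M4 : M <= 4.
    by rewrite leNgt; apply/negP => M5; have : M - 1 < k < M; nia.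
  have : M \in [:: 1; 4].
    by apply: (decide 4%N 4%N (fun x => x * x - x + 4)) => //; nia.
  by rewrite !inE; lia.
- have {}kE : k * k = M * M - 2 * M + 9 by rewrite -expr2 kE; ring.
  have M4 : M <= 4.
    by rewrite leNgt; apply/negP => M5; have : M - 1 < k < M; nia.
  have : M \in [:: 2].
    by apply: (decide 4%N 5%N (fun x => x * x - 2 * x + 9)) => //; nia.
  by rewrite !inE; lia.
have {}kE : k * k = M * M - 4 * M + 25 by rewrite -expr2 kE; ring.
(* The value 12 is attained: [M^2 - 4 M + 25] reaches [(M - 1)^2 = 121] there and stays strictly
   below [(M - 1)^2] afterwards. *)
have M12 : M <= 12.
  by rewrite leNgt; apply/negP => M13; have : M - 2 < k < M - 1; nia.
have : M \in [:: 4; 12].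
  by apply: (decide 12%N 11%N (fun x => x * x - 4 * x + 25)) => //; nia.
by rewrite !inE; lia.
Qed.

Local Close Scope ring_scope.

Theorem theorem2 (a m n : nat) (ha : 1 <= a) (hm : 1 <= m) (hn : 3 <= n) :
  D_integral (EGW a m n) <->
  (a, m, n) \in [:: (1, 4, 3); (4, 1, 3); (2, 2, 3); (1, 1, 3); (1, 2, 4);
                    (2, 1, 4); (1, 4, 6); (2, 2, 6); (4, 1, 6); (1, 12, 6);
                    (2, 6, 6); (3, 4, 6); (4, 3, 6); (6, 2, 6); (12, 1, 6)].
Proof.
split=> [Dint | amn].
  have nE := D_integral_EGW_cycle ha hm hn Dint.
  have [k kE] := D_integral_EGW_square ha hm hn Dint.
  have N_gt0 : 0 < a * m by rewrite muln_gt0 ha.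
  have := square_EGW_params N_gt0 nE kE.
  have [aN mN] : a <= a * m /\ m <= a * m by rewrite leq_pmulr // leq_pmull.
  rewrite !inE !xpair_eqE => amn.
  (* The product [a * m] is at most 12; for each fixed [a] the condition on [a * m] becomes linear
     in [m]. *)
  have a12 : a <= 12 by lia.
  have : a \in iota 1 12 by rewrite mem_iota; lia.
  rewrite !inE; do 11?[case/orP]; move=> /eqP aE; rewrite aE in amn *; lia.
have [k nE kE] : exists2 k : int, n \in [:: 3; 4; 6] &
    (k ^+ 2 = ((a * m)%:Z - n%:Z + 1) ^+ 2 + (a * m * n)%:Z)%R.
  move: amn; rewrite !inE !xpair_eqE.
  (* The roots 2, 3, 4, 5, 11 belong to [(a * m, n)] equal to (1, 3), (2, 4), (4, 3), (4, 6), (12,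
     6). *)
  do 14?[case/orP]; move=> /andP[/andP[/eqP -> /eqP ->] /eqP ->];
    by [exists (Posz 2) | exists (Posz 3) | exists (Posz 4) | exists (Posz 5) | exists (Posz 11)].
exact: (EGW_D_integral ha hm hn nE kE).
Qed.
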